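(* Let $\alpha = \{ \alpha_g : R_{g^{-1}} \rightarrow R_g \}_{g \in \mathrm{mor}(G)}$ be a unital partial action of a groupoid $G$ on an associative ring $R$, and let $\beta = \{ \beta_g : T_{g^{-1}} \rightarrow T_g \}_{g \in \mathrm{mor}(G)}$ be a globalization of $\alpha$ on an associative ring $T=\bigoplus_{e\in\mathrm{ob}(G)}T_e$, with $R_e\subseteq T_e$ for all $e\in\mathrm{ob}(G)$. If $\mathrm{ob}(G)$ is finite and $\alpha$ is of finite type, then $R\star_\alpha G$ is left (respectively right) noetherian if and only if $T\star_\beta G$ is left (respectively right) noetherian. In that case, both $R$ and $T$ are left (respectively right) noetherian.
   Context: A groupoid $G$ is a small category in which all morphisms are isomorphisms, with objects $\mathrm{ob}(G)$ identified with identity morphisms, so $\mathrm{ob}(G)\subseteq\mathrm{mor}(G)$; $d(g)$, $c(g)$ are the domain and codomain of $g$, and $G^2$ is the set of pairs $(g,h)$ with $d(g)=c(h)$. A partial action of $G$ on $R$ is a family $\alpha = \{ \alpha_g : R_{g^{-1}} \to R_g \}_{g \in \mathrm{mor}(G)}$ such that for each $g$, $R_{c(g)}$ is a (two-sided) ideal of $R$, $R_g$ is an ideal of $R_{c(g)}$, $\alpha_g$ is a ring isomorphism, and: (P1) $\alpha_e=\mathrm{id}_{R_e}$ for $e\in\mathrm{ob}(G)$; (P2) if $(g,h)\in G^2$ then $R_{(gh)^{-1}}\supseteq \alpha_h^{-1}(R_h\cap R_{g^{-1}})$; (P3) if $(g,h)\in G^2$ and $x\in\alpha_h^{-1}(R_h\cap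 R_{g^{-1}})$ then $\alpha_g(\alpha_h(x))=\alpha_{gh}(x)$; (P4) $R=\bigoplus_{e\in\mathrm{ob}(G)}R_e$. It is unital if every non-zero $R_g$ is a unital ring, and global if $\alpha_{gh}=\alpha_g\alpha_h$ for $(g,h)\in G^2$ (equivalently $R_g=R_{c(g)}$ for all $g$). A globalization of $\alpha$ (with the embeddings $R_e\to T_e$ taken to be inclusions) is a global action $\beta = \{ \beta_g : T_{g^{-1}} \to T_g \}$ of $G$ on an associative ring $T$ such that for all $g\in\mathrm{mor}(G)$ and $e\in\mathrm{ob}(G)$: (i) $R_e$ is an ideal of $T_e$; (ii) $R_g=R_{c(g)}\cap\beta_g(R_{d(g)})$; (iii) $\beta_g(a)=\alpha_g(a)$ for $a\in R_{g^{-1}}$; (iv) $T_g=\sum_{c(h)=c(g)}\beta_h(R_{d(h)})$. (Every unital partial action on an associative ring admits one.) $\alpha$ is of finite type if for any $e\in\mathrm{ob}(G)$ there are $g_1,\dots,g_n\in\mathrm{mor}(G)$ with codomain $e$ such that $R_{c(g)}=\sum_{i=1}^nR_{gg_i}$ for every $g\in\mathrm{mor}(G)$ with $d(g)=e$. The partial skew groupoid ring $R\star_\alpha G$ is the set of finite formal sums $\sum_{g\in\mathrm{mor}(G)} r_g\delta_g$ with $r_g\in R_g$, with componentwise addition and multiplication determined by $(r_g\delta_g)(r'_h\delta_h)=\alpha_g(\alpha_{g^{-1}}(r_g)r'_h)\delta_{gh}$ if $(g,h)\in G^2$, and $0$ otherwise; $T\star_\beta G$ is defined in the same way from $\beta$.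 *)

(* Defs.v *)
From HB Require Import structures.
From mathcomp Require Import all_boot all_order all_algebra finmap.
From mathcomp.multinomials Require Import monalg.
From mathcomp Require Import boolp classical_sets functions cardinality.

Set Implicit Arguments.
Unset Strict Implicit.
Unset Printing Implicit Defensive.

Import GRing.Theory.
Local Open Scope classical_set_scope.
Local Open Scope ring_scope.

(* Rings here need not have a unit. Partial skew groupoid rings are built for
   arbitrary partial actions, and are then not associative in general, so
   associativity is split off from the rest of the structure. *)
HB.mixin Record Zmodule_isNonAssocRng R of GRing.Zmodule R := {
  rmul : R -> R -> R;
  rmulDl : forall x y z, rmul (x + y) z = rmul x z + rmul y z;
  rmulDr : forall x y z, rmul x (y + z) = rmul x y + rmul x z
}.

#[short(type="nonAssocRngType")]
HB.structure Definition NonAssocRng :=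
  {R of Zmodule_isNonAssocRng R & GRing.Zmodule R}.

HB.mixin Record NonAssocRng_isRng R of NonAssocRng R := {
  rmulA : forall x y z : R, rmul x (rmul y z) = rmul (rmul x y) z
}.

#[short(type="rngType")]
HB.structure Definition Rng := {R of NonAssocRng_isRng R & NonAssocRng R}.

Declare Scope rng_scope.
Delimit Scope rng_scope with rng.
Local Open Scope rng_scope.
Notation "x *' y" := (rmul x y) (at level 40, left associativity) : rng_scope.

Section NonAssocRngTheory.
Variable R : nonAssocRngType.
Implicit Types x y : R.

Lemma rmul0r x : 0 *' x = 0.
Proof. by apply: (addrI (0 *' x)); rewrite -rmulDl !addr0. Qed.

Lemma rmulr0 x : x *' 0 = 0.
Proof. by apply: (addrI (x *' 0)); rewrite -rmulDr !addr0. Qed.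

End NonAssocRngTheory.

Definition subgroup (V : zmodType) (A : set V) : Prop :=
  A 0 /\ forall x y, A x -> A y -> A (x - y).

Definition left_ideal (R : nonAssocRngType) (I : set R) : Prop :=
  subgroup I /\ forall a x, I x -> I (a *' x).

Definition right_ideal (R : nonAssocRngType) (I : set R) : Prop :=
  subgroup I /\ forall a x, I x -> I (x *' a).

Definition left_noetherian (R : nonAssocRngType) : Prop :=
  forall I : nat -> set R, (forall n, left_ideal (I n)) ->
    (forall n, I n `<=` I n.+1) ->
    exists N, forall n, (N <= n)%N -> I n = I N.

Definition right_noetherian (R : nonAssocRngType) : Prop :=
  forall I : nat -> set R, (forall n, right_ideal (I n)) ->
    (forall n, I n `<=` I n.+1) ->
    exists N, forall n, (N <= n)%N -> I n = I N.

(* [A] is a two-sided ideal of the subring [B] of [R]. *)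
Definition ideal_of (R : nonAssocRngType) (B A : set R) : Prop :=
  [/\ subgroup A, A `<=` B &
      forall b a, B b -> A a -> A (b *' a) /\ A (a *' b)].

Definition rng_morphism_on (R S : nonAssocRngType) (A : set R) (f : R -> S) :
    Prop :=
  forall x y, A x -> A y -> f (x + y) = f x + f y /\ f (x *' y) = f x *' f y.

Definition unital_set (R : nonAssocRngType) (A : set R) : Prop :=
  exists2 u, A u & forall x, A x -> u *' x = x /\ x *' u = x.

(* Finitely supported families are elements of [{malg V[I]}]; only its
   underlying additive group is used, never its monoid algebra structure. *)
Section Sums.
Variables (I : choiceType) (V : zmodType).

Definition family_in (P : set I) (A : I -> set V) : set {malg V[I]} :=
  [set f | forall i, f@_i != 0 -> P i /\ A i f@_i].

Definition family_sum (f : {malg V[I]}) : V := \sum_(i <- msupp f) f@_i.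

Definition sum_of_sets (P : set I) (A : I -> set V) : set V :=
  family_sum @` family_in P A.

Definition is_direct_sum (P : set I) (A : I -> set V) : Prop :=
  forall x : V, exists! f, family_in P A f /\ family_sum f = x.

End Sums.

(* One-sorted presentation: objects are the identity morphisms. [gmul g h] is
   a total function, meaningful only when [gdom g = gcod h]. *)
Record groupoid := Groupoid {
  mor :> choiceType;
  gdom : mor -> mor;
  gcod : mor -> mor;
  gmul : mor -> mor -> mor;
  ginv : mor -> mor;
  gcod_dom : forall g, gcod (gdom g) = gdom g;
  gdom_cod : forall g, gdom (gcod g) = gcod g;
  gdomM : forall g h, gdom g = gcod h -> gdom (gmul g h) = gdom h;
  gcodM : forall g h, gdom g = gcod h -> gcod (gmul g h) = gcod g;
  gmulA : forall g h k, gdom g = gcod h -> gdom h = gcod k ->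
    gmul g (gmul h k) = gmul (gmul g h) k;
  gmul1 : forall g, gmul g (gdom g) = g;
  g1mul : forall g, gmul (gcod g) g = g;
  gdomV : forall g, gdom (ginv g) = gcod g;
  gcodV : forall g, gcod (ginv g) = gdom g;
  gmulV : forall g, gmul g (ginv g) = gcod g;
  gVmul : forall g, gmul (ginv g) g = gdom g
}.

Definition ob (G : groupoid) : set G := [set e | gdom e = e].
Arguments ob : clear implicits.

(* [pset g] is R_g. The map alpha_g : R_{g^-1} -> R_g is represented by a total
   function [pfun g], whose values outside R_{g^-1} are irrelevant. *)
Record partial_action (G : groupoid) (R : rngType) := PartialAction {
  pset : G -> set R;
  pfun : G -> R -> R;
  pset_cod : forall g, ideal_of setT (pset (gcod g));
  pset_ideal : forall g, ideal_of (pset (gcod g)) (pset g);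
  pfun_bij : forall g, set_bij (pset (ginv g)) (pset g) (pfun g);
  pfun_morph : forall g, rng_morphism_on (pset (ginv g)) (pfun g);
  pfun_ob : forall e, ob G e -> {in pset e, pfun e =1 id};
  pset_mul : forall g h, gdom g = gcod h ->
    pset (ginv h) `&` pfun h @^-1` (pset h `&` pset (ginv g))
      `<=` pset (ginv (gmul g h));
  pfun_mul : forall g h x, gdom g = gcod h ->
    (pset (ginv h) `&` pfun h @^-1` (pset h `&` pset (ginv g))) x ->
    pfun g (pfun h x) = pfun (gmul g h) x;
  pset_sum : is_direct_sum (ob G) pset
}.

Definition unital_action (G : groupoid) (R : rngType)
    (alpha : partial_action G R) : Prop :=
  forall g, pset alpha g <> [set 0] -> unital_set (pset alpha g).

(* alpha_{gh} = alpha_g alpha_h as partially defined maps. *)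
Definition global_action (G : groupoid) (R : rngType)
    (alpha : partial_action G R) : Prop :=
  forall g h, gdom g = gcod h ->
    pset alpha (ginv (gmul g h)) =
      pset alpha (ginv h) `&`
        pfun alpha h @^-1` (pset alpha h `&` pset alpha (ginv g)) /\
    forall x, pset alpha (ginv (gmul g h)) x ->
      pfun alpha (gmul g h) x = pfun alpha g (pfun alpha h x).

Definition finite_type (G : groupoid) (R : rngType)
    (alpha : partial_action G R) : Prop :=
  forall e, ob G e -> exists n (gs : 'I_n -> G),
    (forall i, gcod (gs i) = e) /\
    forall g, gdom g = e ->
      pset alpha (gcod g) =
        sum_of_sets setT (fun i => pset alpha (gmul g (gs i))).

(* The inclusions R_e -> T_e are given as monomorphisms [emb e], defined on all
   of R but relevant on R_e only. *)
Record globalization (G : groupoid) (R T : rngType)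
    (alpha : partial_action G R) (beta : partial_action G T) :=
  Globalization {
  emb : G -> R -> T;
  glob_global : global_action beta;
  emb_morph : forall e, ob G e -> rng_morphism_on (pset alpha e) (emb e);
  emb_inj : forall e, ob G e -> set_inj (pset alpha e) (emb e);
  glob_ideal : forall e, ob G e ->
    ideal_of (pset beta e) (emb e @` pset alpha e);
  glob_pset : forall g,
    emb (gcod g) @` pset alpha g =
      emb (gcod g) @` pset alpha (gcod g) `&`
        pfun beta g @` (emb (gdom g) @` pset alpha (gdom g));
  glob_pfun : forall g a, pset alpha (ginv g) a ->
    pfun beta g (emb (gdom g) a) = emb (gcod g) (pfun alpha g a);
  glob_sum : forall g,
    pset beta g =
      sum_of_sets [set h | gcod h = gcod g]
        (fun h => pfun beta h @` (emb (gdom h) @` pset alpha (gdom h)))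
}.

Section GroupoidTheory.
Variable G : groupoid.
Implicit Types g h : G.

Lemma gdom_dom g : gdom (gdom g) = gdom g.
Proof. by rewrite -[gdom g]gcod_dom gdom_cod. Qed.

Lemma ginvK g : ginv (ginv g) = g.
Proof.
have gV : gdom (ginv g) = gcod g by rewrite gdomV.
have gVV : gdom (ginv (ginv g)) = gcod (ginv g) by rewrite gdomV.
by rewrite -[LHS]gmul1 gdomV gcodV -gVmul gmulA // gVmul gdomV g1mul.
Qed.

Lemma ginvM g h : gdom g = gcod h ->
  ginv (gmul g h) = gmul (ginv h) (ginv g).
Proof.
move=> gh; have vgh : gdom (ginv h) = gcod (ginv g) by rewrite gdomV gcodV.
have hV : gdom h = gcod (ginv h) by rewrite gcodV.
have ghV : gdom (gmul g h) = gcod (gmul (ginv h) (ginv g)).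
  by rewrite gdomM // gcodM.
have ghK : gmul (gmul g h) (gmul (ginv h) (ginv g)) = gcod g.
  by rewrite gmulA ?gdomM // -(gmulA gh) // gmulV -gh gmul1 gmulV.
rewrite -[LHS]gmul1 gdomV gcodM // -ghK gmulA ?gdomV // gVmul.
by rewrite ghV g1mul.
Qed.

End GroupoidTheory.

Section PartialActionTheory.
Variables (G : groupoid) (R : rngType) (alpha : partial_action G R).
Implicit Types (g h : G) (x y : R).

Lemma pset0 g : pset alpha g 0.
Proof. by case: (pset_ideal alpha g) => -[]. Qed.

Lemma psetB g x y : pset alpha g x -> pset alpha g y -> pset alpha g (x - y).
Proof.
by move=> gx gy; case: (pset_ideal alpha g) => -[_ gB] _ _; apply: gB.
Qed.

Lemma psetD g x y : pset alpha g x -> pset alpha g y -> pset alpha g (x + y).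
Proof.
move=> gx gy; rewrite -[y]opprK; apply: psetB => //.
by rewrite -[- y]add0r; apply: psetB => //; apply: pset0.
Qed.

Lemma pset_sub_cod g : pset alpha g `<=` pset alpha (gcod g).
Proof. by case: (pset_ideal alpha g). Qed.

Lemma psetM g h x y : gcod g = gcod h -> pset alpha g x -> pset alpha h y ->
  pset alpha g (x *' y) /\ pset alpha h (x *' y).
Proof.
move=> gh gx hy; split.
- case: (pset_ideal alpha g) => _ _ /(_ y x) [] // .
  by rewrite gh; apply: pset_sub_cod.
- case: (pset_ideal alpha h) => _ _ /(_ x y) [] // .
  by rewrite -gh; apply: pset_sub_cod.
Qed.

Lemma pfun_pset g x : pset alpha (ginv g) x -> pset alpha g (pfun alpha g x).
Proof.
by move=> gx; case: (pfun_bij alpha g) => gfun _ _; apply: gfun.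
Qed.

Lemma pfunD g x y : pset alpha (ginv g) x -> pset alpha (ginv g) y ->
  pfun alpha g (x + y) = pfun alpha g x + pfun alpha g y.
Proof. by move=> gx gy; case: (pfun_morph gx gy). Qed.

Lemma pfun0 g : pfun alpha g 0 = 0.
Proof.
apply: (addrI (pfun alpha g 0)).
by rewrite -pfunD ?addr0 //; apply: pset0.
Qed.

Lemma pfunK g x : pset alpha (ginv g) x ->
  pfun alpha (ginv g) (pfun alpha g x) = x.
Proof.
move=> gx; rewrite pfun_mul ?gdomV //; last first.
  by split=> //; rewrite ginvK; split; apply: pfun_pset.
rewrite gVmul pfun_ob ?inE //; first exact: gdom_dom.
by rewrite -gcodV; apply: pset_sub_cod.
Qed.

Lemma pfun_pset_mul g h x : gdom g = gcod h ->
  pset alpha (ginv g) x -> pset alpha h x ->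
  pset alpha (gmul g h) (pfun alpha g x).
Proof.
move=> gh gx hx; have vgh : gdom (ginv h) = gcod (ginv g).
  by rewrite gdomV gcodV.
rewrite -[gmul g h]ginvK ginvM //; apply: (pset_mul vgh).
by rewrite !ginvK; split; [apply: pfun_pset | rewrite /= pfunK].
Qed.

Lemma skew_coef_pset g h x y : gdom g = gcod h ->
  pset alpha g x -> pset alpha h y ->
  pset alpha (ginv g) (pfun alpha (ginv g) x *' y) /\
  pset alpha h (pfun alpha (ginv g) x *' y).
Proof.
move=> gh gx hy; apply: psetM => //; first by rewrite gcodV.
by apply: pfun_pset; rewrite ginvK.
Qed.

End PartialActionTheory.

(* The formal sum [\sum_g r_g delta_g] is the element [f] of [{malg R[G]}] with
   [f@_g = r_g]. *)
Section SkewGroupoidRing.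
Variables (G : groupoid) (R : rngType) (alpha : partial_action G R).
Implicit Types (g h : G) (x y : R) (a b : {malg R[G]}).

Definition in_skew : {pred {malg R[G]}} :=
  fun a => `[< forall g, pset alpha g a@_g >].

Fact in_skew_zmod_closed : zmod_closed in_skew.
Proof.
split=> [|a b /asboolP ga /asboolP gb]; apply/asboolP=> g.
  by rewrite mcoeff0; apply: pset0.
by rewrite mcoeffB; apply: psetB.
Qed.

HB.instance Definition _ :=
  GRing.isZmodClosed.Build {malg R[G]} in_skew in_skew_zmod_closed.

Record partial_skew_groupoid_ring :=
  PartialSkewGroupoidRing { skew_val : {malg R[G]}; _ : skew_val \in in_skew }.

HB.instance Definition _ := [isSub for skew_val].
HB.instance Definition _ := [Choice of partial_skew_groupoid_ring by <:].
HB.instance Definition _ :=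
  [SubChoice_isSubZmodule of partial_skew_groupoid_ring by <:].

(* (x delta_g) (y delta_h) when d(g) = c(h) *)
Definition skew_mul1 g h x y : {malg R[G]} :=
  << pfun alpha g (pfun alpha (ginv g) x *' y) *g gmul g h >>.

Definition skew_mul a b : {malg R[G]} :=
  \sum_(g <- msupp a) \sum_(h <- msupp b | gdom g == gcod h)
    skew_mul1 g h a@_g b@_h.

Lemma skew_mul10 g h x : skew_mul1 g h x 0 = 0.
Proof. by rewrite /skew_mul1 rmulr0 pfun0 monalgU0. Qed.

Lemma skew_mul01 g h y : skew_mul1 g h 0 y = 0.
Proof. by rewrite /skew_mul1 pfun0 rmul0r pfun0 monalgU0. Qed.

Lemma skew_mul1Dl g h x1 x2 y : gdom g = gcod h -> pset alpha g x1 ->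
  pset alpha g x2 -> pset alpha h y ->
  skew_mul1 g h (x1 + x2) y = skew_mul1 g h x1 y + skew_mul1 g h x2 y.
Proof.
move=> gh gx1 gx2 hy; rewrite /skew_mul1 pfunD ?ginvK // rmulDl.
rewrite pfunD ?monalgUD //.
- by case: (skew_coef_pset gh gx1 hy).
- by case: (skew_coef_pset gh gx2 hy).
Qed.

Lemma skew_mul1Dr g h x y1 y2 : gdom g = gcod h -> pset alpha g x ->
  pset alpha h y1 -> pset alpha h y2 ->
  skew_mul1 g h x (y1 + y2) = skew_mul1 g h x y1 + skew_mul1 g h x y2.
Proof.
move=> gh gx hy1 hy2; rewrite /skew_mul1 rmulDr pfunD ?monalgUD //.
- by case: (skew_coef_pset gh gx hy1).
- by case: (skew_coef_pset gh gx hy2).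
Qed.

Lemma skew_mulw (d1 d2 : {fset G}) a b :
  (msupp a `<=` d1)%fset -> (msupp b `<=` d2)%fset ->
  skew_mul a b =
    \sum_(g <- d1) \sum_(h <- d2 | gdom g == gcod h)
      skew_mul1 g h a@_g b@_h.
Proof.
move=> ad1 bd2; rewrite /skew_mul (big_fset_incl _ ad1) /=; last first.
  move=> g _ /mcoeff_outdom ->; rewrite big1 // => h _; exact: skew_mul01.
apply: eq_bigr => g _; rewrite big_mkcond [RHS]big_mkcond /=.
apply: big_fset_incl => // h _ /mcoeff_outdom ->.
by rewrite skew_mul10 if_same.
Qed.

Fact skew_mul_closed a b :
  a \in in_skew -> b \in in_skew -> skew_mul a b \in in_skew.
Proof.
move=> /asboolP ga /asboolP gb; apply: rpred_sum => g _.
apply: rpred_sum => h /eqP gh; apply/asboolP => k.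
rewrite /skew_mul1 mcoeffU; case: eqP => [<-|_] /=; last exact: pset0.
rewrite mulr1n.
by have [? ?] := skew_coef_pset gh (ga g) (gb h); apply: pfun_pset_mul.
Qed.

Definition skew_rmul (s t : partial_skew_groupoid_ring) :=
  PartialSkewGroupoidRing (skew_mul_closed (valP s) (valP t)).

Fact skew_rmulDl s t u :
  skew_rmul (s + t) u = skew_rmul s u + skew_rmul t u.
Proof.
case: s t u => [a ain] [b bin] [c cin]; apply/val_inj => /=.
move/asboolP: (ain) (bin) (cin) => ga /asboolP gb /asboolP gc.
pose d := (msupp a `|` msupp b)%fset.
have ad : (msupp a `<=` d)%fset by apply: fsubsetUl.
have bd : (msupp b `<=` d)%fset by apply: fsubsetUr.
have abd : (msupp (a + b) `<=` d)%fset by apply: msuppD_le.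
rewrite !(skew_mulw (d1 := d) (d2 := msupp c)) // -big_split /=.
apply: eq_bigr => g _; rewrite -big_split /=; apply: eq_bigr => h /eqP gh.
by rewrite mcoeffD skew_mul1Dl.
Qed.

Fact skew_rmulDr s t u :
  skew_rmul s (t + u) = skew_rmul s t + skew_rmul s u.
Proof.
case: s t u => [a ain] [b bin] [c cin]; apply/val_inj => /=.
move/asboolP: (ain) (bin) (cin) => ga /asboolP gb /asboolP gc.
pose d := (msupp b `|` msupp c)%fset.
have bd : (msupp b `<=` d)%fset by apply: fsubsetUl.
have cd : (msupp c `<=` d)%fset by apply: fsubsetUr.
have bcd : (msupp (b + c) `<=` d)%fset by apply: msuppD_le.
rewrite !(skew_mulw (d1 := msupp a) (d2 := d)) // -big_split /=.
apply: eq_bigr => g _; rewrite -big_split /=; apply: eq_bigr => h /eqP gh.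
by rewrite mcoeffD skew_mul1Dr.
Qed.

HB.instance Definition _ :=
  Zmodule_isNonAssocRng.Build partial_skew_groupoid_ring skew_rmulDl skew_rmulDr.

End SkewGroupoidRing.

(* Main.v *)
Require Import Defs.
From mathcomp Require Import all_boot all_algebra.
From mathcomp Require Import classical_sets cardinality.
From HB Require Import structures.
From mathcomp Require Import finmap boolp.
From mathcomp.multinomials Require Import monalg.

(* Let [S] be the skew ring of [beta] and [eps] the sum of the [1_{R_e} delta_e]
   over the objects [e]. Since [R_g] is the intersection of [R_{c(g)}] and
   [beta_g (R_{d(g)})], the skew ring of [alpha] is the corner [eps S eps].
   Finite type makes each [T_e] a finite sum of unital ideals
   [beta_h (R_{d(h)})], so [S] is unital, and [eps] is full because these ideals
   generate [T_e]. A unital ring and its corner by a full idempotent are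
   noetherian simultaneously. The coefficient ring inherits the property because
   a left (right) ideal [J] of it is recovered, at the objects, from the left
   (right) ideal of all [sum_g r_g delta_g] with every [alpha_{g^-1}(r_g)]
   (every [r_g]) in [J]. *)

Set Implicit Arguments.
Unset Strict Implicit.
Unset Printing Implicit Defensive.

Import GRing.Theory.
Local Open Scope classical_set_scope.
Local Open Scope ring_scope.
Local Open Scope rng_scope.

(** * Additive subgroups *)

Section Subgroups.
Variables (V : zmodType) (A : set V).
Hypothesis sgA : subgroup A.

Lemma subgroup0 : A 0. Proof. by case: sgA. Qed.

Lemma subgroupB x y : A x -> A y -> A (x - y).
Proof. by case: sgA => _; apply. Qed.

Lemma subgroupD x y : A x -> A y -> A (x + y).
Proof.
move=> Ax Ay; rewrite -[y]opprK; apply: subgroupB => //.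
by rewrite -[- y]add0r; apply: subgroupB => //; apply: subgroup0.
Qed.

Lemma subgroup_sum (I : eqType) (r : seq I) (P : pred I) (F : I -> V) :
  (forall i, i \in r -> P i -> A (F i)) -> A (\sum_(i <- r | P i) F i).
Proof.
move=> AF; rewrite big_seq_cond; apply: (big_ind A); first exact: subgroup0.
  exact: subgroupD.
by move=> i /andP[ir Pi]; apply: AF.
Qed.

End Subgroups.

(** * Products in nonassociative rings without unit *)

Section Products.
Variable R : nonAssocRngType.
Implicit Types x y : R.

Lemma rmulNr x y : x *' (- y) = - (x *' y).
Proof. by apply/eqP; rewrite -addr_eq0 -rmulDr addNr rmulr0. Qed.

Lemma rmulNl x y : (- x) *' y = - (x *' y).
Proof. by apply/eqP; rewrite -addr_eq0 -rmulDl addNr rmul0r. Qed.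

Lemma rmulBr x y z : x *' (y - z) = x *' y - x *' z.
Proof. by rewrite rmulDr rmulNr. Qed.

Lemma rmulBl x y z : (x - y) *' z = x *' z - y *' z.
Proof. by rewrite rmulDl rmulNl. Qed.

Lemma rmul_sumr (I : Type) (r : seq I) (P : pred I) (F : I -> R) x :
  x *' (\sum_(i <- r | P i) F i) = \sum_(i <- r | P i) x *' F i.
Proof. by apply: (big_morph _ (rmulDr x) (rmulr0 x)). Qed.

Lemma rmul_suml (I : Type) (r : seq I) (P : pred I) (F : I -> R) x :
  (\sum_(i <- r | P i) F i) *' x = \sum_(i <- r | P i) F i *' x.
Proof.
by apply: (big_morph (fun y => y *' x) (fun y z => rmulDl y z x) (rmul0r x)).
Qed.

End Products.

(** * Ascending chains of sets *)

Lemma chain_mono (X : Type) (I : nat -> set X) :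
  (forall n, I n `<=` I n.+1) -> forall m n, (m <= n)%N -> I m `<=` I n.
Proof.
move=> Imono m n /subnK <-; elim: (n - m)%N => [|k IHk] x Ix //.
by rewrite addSn; apply: Imono; apply: IHk.
Qed.

(** This is the conclusion of both noetherian conditions; for ascending chains the next two lemmas
    trade it for inclusion in a single term. *)
Definition stabilizes (X : Type) (I : nat -> set X) : Prop :=
  exists N, forall n, (N <= n)%N -> I n = I N.

Lemma stabilizesP (X : Type) (I : nat -> set X) :
  (forall n, I n `<=` I n.+1) ->
  (exists N, forall n, I n `<=` I N) -> stabilizes I.
Proof.
move=> Imono [N IN]; exists N => n Nn; apply/seteqP; split; first exact: IN.
exact: chain_mono.
Qed.

Lemma stabilizes_sub (X : Type) (I : nat -> set X) :
  (forall n, I n `<=` I n.+1) -> stabilizes I ->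
  exists N, forall n, I n `<=` I N.
Proof.
move=> Imono [N IN]; exists N => n; have [/IN-> //|/ltnW nN] := leqP N n.
exact: chain_mono.
Qed.

(** * Left noetherianity of a ring and of its corner by a full idempotent *)

Section Corner.
Variables (A S : nonAssocRngType) (phi : A -> S) (e : S).
Variable ps : seq (S * S).
Hypothesis mulA : forall x y z : S, x *' (y *' z) = (x *' y) *' z.
Hypothesis phiB : forall a b, phi (a - b) = phi a - phi b.
Hypothesis phiM : forall a b, phi (a *' b) = phi a *' phi b.
Hypothesis phiI : injective phi.
Hypothesis phi_corner : forall a, (e *' phi a) *' e = phi a.
Hypothesis corner_phi : forall s, exists a, phi a = (e *' s) *' e.
Hypothesis ee : e *' e = e.
(** The hypotheses on [one] make [e] full: [ps] writes the identity of [S] as an element of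
    [S e S]. *)
Let one := \sum_(p <- ps) p.1 *' (e *' p.2).
Hypothesis mul1s : forall s, one *' s = s.
Hypothesis muls1 : forall s, s *' one = s.

Let phi0 : phi 0 = 0. Proof. by rewrite -[X in phi X](subrr 0) phiB subrr. Qed.
Let e_phi a : e *' phi a = phi a.
Proof. by rewrite -{1}(phi_corner a) !mulA ee phi_corner. Qed.

(** [S] is viewed as a left [A]-module through [phi]; the module of interest is [e S]. *)
Definition submodule (X : set S) :=
  subgroup X /\ forall a x, X x -> X (phi a *' x).

Definition noetherian_submodule (M : set S) :=
  forall X : nat -> set S, (forall n, submodule (X n)) ->
    (forall n, X n `<=` X n.+1) -> (forall n, X n `<=` M) ->
    exists N, forall n, X n `<=` X N.

(** The recursion keeps the coefficient of the head [b] visible, for the induction in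
    [noetherian_span]. *)
Fixpoint span (bs : seq S) : set S :=
  if bs is b :: bs' then [set x | exists a, span bs' (x - phi a *' b)]
  else [set 0].

Lemma span_submodule bs : submodule (span bs).
Proof.
elim: bs => [|b bs [IHg IHm]] /=.
  split; last by move=> a x ->; rewrite rmulr0.
  by split=> // x y -> ->; rewrite subrr.
split; first split.
- by exists 0; rewrite phi0 rmul0r subr0; apply: subgroup0.
- move=> x y [a xa] [c yc]; exists (a - c).
  by rewrite phiB rmulBl opprD addrACA -opprD; apply: subgroupB.
- move=> a x [c xc]; exists (a *' c).
  by rewrite phiM -mulA -rmulBr; apply: IHm.
Qed.

(* Only the "leading" coefficients of [b] matter modulo [span bs]; they form
   an ascending chain of left ideals of [A]. *)
Lemma noetherian_span bs : left_noetherian A -> noetherian_submodule (span bs).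
Proof.
move=> noethA; elim: bs => [|b bs IHbs] /= X Xsub Xmono XM.
  exists 0%N => n x /XM ->; apply: subgroup0; by case: (Xsub 0%N).
have [spg spm] := span_submodule bs.
pose L n := [set a | exists2 m, span bs m & X n (m + phi a *' b)].
have Lideal n : left_ideal (L n).
  have [Xg Xm] := Xsub n; split; first split.
  - by exists 0; [apply: subgroup0|rewrite phi0 rmul0r addr0; apply: subgroup0].
  - move=> a c [m Mm Xa] [k Mk Xc]; exists (m - k); first exact: subgroupB.
    by rewrite phiB rmulBl addrACA -opprD; apply: subgroupB.
  - move=> a c [m Mm Xc]; exists (phi a *' m); first exact: spm.
    by rewrite phiM -mulA -rmulDr; apply: Xm.
have Lmono n : L n `<=` L n.+1.
  by move=> a [m Mm Xm]; exists m => //; apply: Xmono.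
have [N1 LN1] := stabilizes_sub Lmono (noethA L Lideal Lmono).
have [] := IHbs (fun n => X n `&` span bs).
- move=> n; have [Xg Xm] := Xsub n; split; first split.
  + by split; apply: subgroup0.
  + by move=> x y [? ?] [? ?]; split; apply: subgroupB.
  + by move=> a x [? ?]; split; [apply: Xm|apply: spm].
- by move=> n x [? ?]; split=> //; apply: Xmono.
- by move=> n x [].
move=> N2 XN2; exists (maxn N1 N2) => n x Xx.
have [a Ma] := XM n x Xx.
have [m Mm XN] : L N1 a.
  by apply: (LN1 n); exists (x - phi a *' b) => //; rewrite subrK.
(* The element [y] below has the same coefficient [a] at [b] as [x], so [x - y] lies in [span bs].
   Both belong to [X k], and the bound [N2] applies to their difference. *)
pose k := maxn n (maxn N1 N2).
have Xg := (Xsub (maxn N1 N2)).1.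
set y := m + phi a *' b in XN.
have Xy : X (maxn N1 N2) y by apply: chain_mono XN => //; apply: leq_maxl.
rewrite -(subrK y x); apply: subgroupD => //.
apply: (chain_mono Xmono (leq_maxr N1 N2)).
apply: (XN2 k _ _).1; split.
  apply: subgroupB; first by have [] := Xsub k.
    by apply: chain_mono Xx => //; apply: leq_maxl.
  by apply: chain_mono Xy => //; apply: leq_maxr.
by rewrite /y opprD addrCA addrC; apply: subgroupB.
Qed.

(** Each term is [(e (s p.1) e) (e p.2)], whose first factor lies in the corner. For [cs := ps] the
    sum is the identity, so the [e p.2] generate [e S] over [A]. *)
Lemma span_corner (cs : seq (S * S)) s :
  span [seq e *' p.2 | p <- cs] ((e *' s) *' \sum_(p <- cs) p.1 *' (e *' p.2)).
Proof.
elim: cs => [|p cs IHcs] /=; first by rewrite big_nil rmulr0.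
have [a pa] := corner_phi (s *' p.1); exists a.
suff -> : phi a *' (e *' p.2) = (e *' s) *' (p.1 *' (e *' p.2)).
  by rewrite big_cons rmulDr addrC addKr.
by rewrite pa !mulA -(mulA _ e e) ee.
Qed.

(** A left ideal [J] is determined by [e J], since [x] is the sum of the [p.1 (e (p.2 x))]. The sets
    [e J] are submodules of [e S], which is finitely generated over [A]. *)
Lemma left_noetherian_of_corner : left_noetherian A -> left_noetherian S.
Proof.
move=> noethA J Jideal Jmono; apply: stabilizesP => //.
have [] := @noetherian_span [seq e *' p.2 | p <- ps] noethA
  (fun n => [set x | J n x /\ e *' x = x]).
- move=> n; have [Jg Jm] := Jideal n; split; first split.
  + by split; rewrite ?rmulr0 //; apply: subgroup0.
  + by move=> x y [? ex] [? ey]; split; rewrite ?rmulBr ?ex ?ey //;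
      apply: subgroupB.
  + by move=> a x [Jx ex]; split; [apply: Jm|rewrite mulA e_phi].
- by move=> n x [? ?]; split=> //; apply: Jmono.
- by move=> n x [_ ex]; rewrite -(muls1 x) -ex; apply: span_corner.
move=> N XN; exists N => n x Jx; rewrite -(mul1s x) rmul_suml.
have [Jg Jm] := Jideal N; apply: subgroup_sum => // p _ _.
rewrite -mulA; apply: Jm; apply: (XN n _ _).1; split.
  have [_ Jnm] := Jideal n; rewrite -mulA; apply: (Jnm); exact: Jnm.
by rewrite !mulA ee.
Qed.

(* The conductor of [I] into [S e]: it meets the corner exactly in [phi I]. *)
Let extend (I : set A) : set S :=
  [set s | s *' e = s /\ forall t, exists2 a, I a & phi a = e *' (t *' s)].

Lemma left_noetherian_corner : left_noetherian S -> left_noetherian A.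
Proof.
move=> noethS I Iideal Imono; apply: stabilizesP => //.
have Eideal n : left_ideal (extend (I n)).
  have [Ig Im] := Iideal n; split; first split.
  - split=> [|t]; first by rewrite rmul0r.
    by exists 0; [apply: subgroup0|rewrite !rmulr0].
  - move=> x y [xe Ex] [ye Ey]; split=> [|t]; first by rewrite rmulBl xe ye.
    have [a Ia pa] := Ex t; have [b Ib pb] := Ey t.
    by exists (a - b); [apply: subgroupB|rewrite phiB pa pb !rmulBr].
  - move=> u x [xe Ex]; split=> [|t]; first by rewrite -mulA xe.
    by have [a Ia pa] := Ex (t *' u); exists a; rewrite // pa !mulA.
have Emono n : extend (I n) `<=` extend (I n.+1).
  move=> x [xe Ex]; split=> // t; have [a Ia pa] := Ex t.
  by exists a => //; apply: Imono.
have [N EN] := stabilizes_sub Emono (noethS _ Eideal Emono).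
exists N => n a Ia; have [Ig Im] := Iideal n.
(* Taking [t := e] in the conductor condition gives back [e (e (phi a))], that is, [phi a]. *)
have /EN[_ /(_ e)[b Ib]] : extend (I n) (phi a).
  split=> [|t]; first by rewrite -(phi_corner a) -!mulA ee.
  have [b pb] := corner_phi t.
  by exists (b *' a); [apply: Im|rewrite phiM pb -!mulA e_phi].
by rewrite !e_phi => /phiI <-.
Qed.

End Corner.

(** * The opposite ring, and both sides of the corner equivalence *)

Definition converse (R : nonAssocRngType) : Type := R.

HB.instance Definition _ (R : nonAssocRngType) :=
  GRing.Zmodule.on (converse R).
HB.instance Definition _ (R : nonAssocRngType) :=
  @Zmodule_isNonAssocRng.Build (converse R) (fun x y => (y : R) *' x)
    (fun x y z => rmulDr (z : R) x y) (fun x y z => rmulDl (y : R) z x).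

(** Left multiplication in [converse R] unfolds to right multiplication in [R], so the two sides are
    convertible. *)
Lemma right_noetherianE (R : nonAssocRngType) :
  right_noetherian R = left_noetherian (converse R).
Proof. by []. Qed.

Section CornerEquivalence.
Variables (A S : nonAssocRngType) (phi : A -> S) (e : S).
Variable ps : seq (S * S).
Hypothesis mulA : forall x y z : S, x *' (y *' z) = (x *' y) *' z.
Hypothesis phiB : forall a b, phi (a - b) = phi a - phi b.
Hypothesis phiM : forall a b, phi (a *' b) = phi a *' phi b.
Hypothesis phiI : injective phi.
Hypothesis phi_corner : forall a, (e *' phi a) *' e = phi a.
Hypothesis corner_phi : forall s, exists a, phi a = (e *' s) *' e.
Hypothesis ee : e *' e = e.
Let one := \sum_(p <- ps) p.1 *' (e *' p.2).
Hypothesis mul1s : forall s, one *' s = s.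
Hypothesis muls1 : forall s, s *' one = s.

Lemma left_noetherian_cornerE : left_noetherian A <-> left_noetherian S.
Proof.
split; first exact: (left_noetherian_of_corner mulA phiB phiM phi_corner
  corner_phi ee mul1s).
exact: (left_noetherian_corner mulA phiB phiM phiI phi_corner).
Qed.

Lemma right_noetherian_cornerE : right_noetherian A <-> right_noetherian S.
Proof.
pose Ac := converse A; pose Sc := converse S; pose ec : Sc := e.
pose phic : Ac -> Sc := phi.
have mulAc (x y z : Sc) : x *' (y *' z) = (x *' y) *' z.
  by exact: (esym (mulA z y x)).
have phicB (a b : Ac) : phic (a - b) = phic a - phic b by exact: phiB.
have phicM (a b : Ac) : phic (a *' b) = phic a *' phic b by exact: phiM.
have phic_corner a : (ec *' phic a) *' ec = phic a.
  by rewrite -mulAc; exact: (phi_corner a).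
have corner_phic s : exists a, phic a = (ec *' s) *' ec.
  by have [a pa] := corner_phi s; exists a; rewrite -mulAc.
have eec : ec *' ec = ec by exact: ee.
(* Reversing products turns [p.1 (e p.2)] around, so the pairs are swapped; the two unit laws
   exchange roles as well. *)
pose psc := [seq ((p.2 : Sc), (p.1 : Sc)) | p <- ps].
have oneE : \sum_(p <- psc) p.1 *' (ec *' p.2) = one :> Sc.
  by rewrite big_map; apply: eq_bigr => p _; rewrite mulAc.
rewrite !right_noetherianE; split.
  apply: (left_noetherian_of_corner (ps := psc) mulAc phicB phicM) => // s.
    by rewrite oneE; apply: muls1.
  by rewrite oneE; apply: mul1s.
exact: (left_noetherian_corner mulAc phicB phicM phiI).
Qed.

End CornerEquivalence.

(** * Identity morphisms *)

Section Objects.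
Variable G : groupoid.
Implicit Types e g : G.

Lemma gcod_ob g : ob G (gcod g). Proof. exact: gdom_cod. Qed.
Lemma gdom_ob g : ob G (gdom g). Proof. exact: gdom_dom. Qed.

Lemma gcod_id e : ob G e -> gcod e = e.
Proof. by move=> oe; rewrite -oe gcod_dom. Qed.

Lemma ginv_ob e : ob G e -> ginv e = e.
Proof.
by move=> oe; rewrite -[LHS]g1mul gcodV oe gmulV gcod_id.
Qed.

End Objects.

#[local] Hint Resolve gcod_ob gdom_ob : core.

Lemma pfunB (G : groupoid) (R : rngType) (alpha : partial_action G R) g x y :
  pset alpha (ginv g) x -> pset alpha (ginv g) y ->
  pfun alpha g (x - y) = pfun alpha g x - pfun alpha g y.
Proof.
move=> gx gy; apply/eqP; rewrite eq_sym subr_eq -pfunD ?subrK //.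
exact: psetB.
Qed.

(** * Homogeneous elements of the skew ring, and ideals defined by coefficients *)

Section SkewSingle.
Variables (G : groupoid) (R : rngType) (alpha : partial_action G R).
Local Notation A := (partial_skew_groupoid_ring alpha).
Implicit Types (g h : G) (x y : R) (s t : A).

Definition scoef g s : R := (val s)@_g.

Lemma scoef_pset g s : pset alpha g (scoef g s).
Proof. by have /asboolP := valP s; apply. Qed.

Lemma scoefP s t : (forall g, scoef g s = scoef g t) -> s = t.
Proof. by move=> st; apply/val_inj/malgP. Qed.

Lemma scoef0 g : scoef g 0 = 0. Proof. exact: mcoeff0. Qed.
Lemma scoefD g s t : scoef g (s + t) = scoef g s + scoef g t.
Proof. exact: mcoeffD. Qed.
Lemma scoefB g s t : scoef g (s - t) = scoef g s - scoef g t.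
Proof. exact: mcoeffB. Qed.

(** The element [x delta_g]. It is total in [x], with default value 0 when [x] is outside [R_g];
    hence the membership hypotheses in the lemmas below. *)
Definition single g x : A := insubd (0 : A) << x *g g >>.

Lemma single_val g x : pset alpha g x -> val (single g x) = << x *g g >>.
Proof.
move=> gx; rewrite insubdK //; apply/asboolP => h; rewrite mcoeffU.
by case: eqP => [<-|_]; rewrite ?mulr1n //; apply: pset0.
Qed.

Lemma scoef_single g h x : pset alpha g x ->
  scoef h (single g x) = if g == h then x else 0.
Proof.
move=> gx; rewrite /scoef single_val // mcoeffU.
by case: eqP => _; rewrite ?mulr1n.
Qed.

Lemma single0 g : single g 0 = 0.
Proof.
have g0 := pset0 alpha g; apply/val_inj.
by rewrite single_val // monalgU0 raddf0.
Qed.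

Lemma singleD g x y : pset alpha g x -> pset alpha g y ->
  single g (x + y) = single g x + single g y.
Proof.
move=> gx gy; apply/val_inj; rewrite raddfD /= !single_val ?monalgUD //.
exact: psetD.
Qed.

Lemma skew_sumE s : s = \sum_(g <- msupp (val s)) single g (scoef g s).
Proof.
apply/val_inj; rewrite raddf_sum [LHS]monalgE; apply: eq_bigr => g _.
by rewrite /= single_val //; apply: scoef_pset.
Qed.

(** Reduces additive statements to homogeneous elements. *)
Lemma skew_ind (P : A -> Prop) :
  P 0 -> (forall s t, P s -> P t -> P (s + t)) ->
  (forall g x, pset alpha g x -> P (single g x)) -> forall s, P s.
Proof.
move=> P0 PD P1 s; rewrite [s]skew_sumE; apply: (big_ind P) => // g _.
by apply: P1; apply: scoef_pset.
Qed.

Lemma single_mul_val g h x y : pset alpha g x -> pset alpha h y ->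
  val (single g x *' single h y) =
    if gdom g == gcod h then skew_mul1 alpha g h x y else 0.
Proof.
move=> gx hy.
rewrite /= (skew_mulw _ (d1 := [fset g]%fset) (d2 := [fset h]%fset));
  rewrite ?single_val ?msuppU_le //.
by rewrite !big_seq_fset1 mcoeffUU big_mkcond big_seq_fset1 mcoeffUU.
Qed.

Lemma single_mul g h x y : gdom g = gcod h ->
  pset alpha g x -> pset alpha h y ->
  single g x *' single h y =
    single (gmul g h) (pfun alpha g (pfun alpha (ginv g) x *' y)).
Proof.
move=> gh gx hy; apply/val_inj; rewrite single_mul_val // gh eqxx single_val //.
by have [? ?] := skew_coef_pset gh gx hy; apply: pfun_pset_mul.
Qed.

Lemma single_mul0 g h x y : gdom g <> gcod h ->
  pset alpha g x -> pset alpha h y -> single g x *' single h y = 0.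
Proof.
move=> /eqP/negPf gh gx hy; apply/val_inj.
by rewrite single_mul_val // gh raddf0.
Qed.

(** [K] may vary with [g]: left ideals of [R] will be pulled back along [alpha_{g^-1}], whereas
    right ideals give a constant family. *)
Definition coef_in (K : G -> set R) : set A :=
  [set s | forall g, K g (scoef g s)].

Lemma coef_in_subgroup K : (forall g, subgroup (K g)) -> subgroup (coef_in K).
Proof.
move=> Kg; split=> [g|s t Ks Kt g]; first by rewrite scoef0; apply: subgroup0.
by rewrite scoefB; apply: subgroupB.
Qed.

Lemma coef_in_single K g x : (forall g, subgroup (K g)) ->
  pset alpha g x -> K g x -> coef_in K (single g x).
Proof.
move=> Kg gx Kx h; rewrite scoef_single //; case: eqP => [<-|_] //.
exact: subgroup0.
Qed.

Lemma coef_in_left_ideal K : (forall g, subgroup (K g)) ->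
  (forall g h x y, gdom g = gcod h -> pset alpha g x -> pset alpha h y ->
     K h y -> K (gmul g h) (pfun alpha g (pfun alpha (ginv g) x *' y))) ->
  left_ideal (coef_in K).
Proof.
move=> Kg KM; have Ksg := coef_in_subgroup Kg; split=> // s t Kt.
elim/skew_ind: s => [|s1 s2|g x gx]; first by rewrite rmul0r; apply: subgroup0.
  by rewrite rmulDl; apply: subgroupD.
rewrite [t]skew_sumE rmul_sumr; apply: subgroup_sum => // h _ _.
have ht := scoef_pset h t.
have [gh|gh] := eqVneq (gdom g) (gcod h); last first.
  by rewrite single_mul0 //; [apply: subgroup0|apply/eqP].
rewrite single_mul //; apply: coef_in_single => //; last exact: KM.
by have [? ?] := skew_coef_pset gh gx ht; apply: pfun_pset_mul.
Qed.

Lemma coef_in_right_ideal K : (forall g, subgroup (K g)) ->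
  (forall g h x y, gdom g = gcod h -> pset alpha g x -> pset alpha h y ->
     K g x -> K (gmul g h) (pfun alpha g (pfun alpha (ginv g) x *' y))) ->
  right_ideal (coef_in K).
Proof.
move=> Kg KM; have Ksg := coef_in_subgroup Kg; split=> // s t Kt.
elim/skew_ind: s => [|s1 s2|h y hy]; first by rewrite rmulr0; apply: subgroup0.
  by rewrite rmulDr; apply: subgroupD.
rewrite [t]skew_sumE rmul_suml; apply: subgroup_sum => // g _ _.
have gt := scoef_pset g t.
have [gh|gh] := eqVneq (gdom g) (gcod h); last first.
  by rewrite single_mul0 //; [apply: subgroup0|apply/eqP].
rewrite single_mul //; apply: coef_in_single => //; last exact: KM.
by have [? ?] := skew_coef_pset gh gt hy; apply: pfun_pset_mul.
Qed.

End SkewSingle.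

(** * From the skew ring to its coefficient ring *)

Section CoefficientRing.
Variables (G : groupoid) (R : rngType) (alpha : partial_action G R).
Hypothesis unital_pset : forall g, unital_set (pset alpha g).
Local Notation A := (partial_skew_groupoid_ring alpha).
Implicit Types (g h : G) (x y : R) (s t : A).

Lemma family_in_single (e : G) x : ob G e -> pset alpha e x ->
  family_in (ob G) (pset alpha) << x *g e >>.
Proof.
move=> oe ex h; rewrite mcoeffU; case: (e =P h) => [<-|_] //=.
by rewrite eqxx.
Qed.

Lemma family_sum_single (I : choiceType) (V : zmodType) (i : I) (v : V) :
  family_sum << v *g i >> = v.
Proof.
rewrite /family_sum msuppU; case: eqP => [->|_].
  by rewrite big_seq_fset0.
by rewrite big_seq_fset1 mcoeffUU.
Qed.

(** Such an [x] has two one-term decompositions, at [e] and at [f]; they coincide by uniqueness in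
    [pset_sum], and the coefficients at [e] are compared. *)
Lemma pset_ob_disjoint (e f : G) x : ob G e -> ob G f -> e <> f ->
  pset alpha e x -> pset alpha f x -> x = 0.
Proof.
move=> oe of_ ef ex fx; have [m [_ mU]] := pset_sum alpha x.
have me := mU _ (conj (family_in_single oe ex) (family_sum_single e x)).
have mf := mU _ (conj (family_in_single of_ fx) (family_sum_single f x)).
have := congr1 (mcoeff e) (etrans (esym me) mf).
by rewrite mcoeffUU mcoeffU; case: eqP => // /esym/ef.
Qed.

(** Packages the decomposition of [x] given by [pset_sum] as an element of the skew ring, so that
    ideals of the latter can be tested on it. *)
Lemma object_parts x : exists2 s : A, family_sum (val s) = x &
  forall g, ~ ob G g -> scoef g s = 0.
Proof.
have [m [[mP mx] _]] := pset_sum alpha x.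
have min : m \in in_skew alpha.
  apply/asboolP => g; have [->|/mP[]//] := eqVneq m@_g 0; exact: pset0.
exists (PartialSkewGroupoidRing min) => // g ng; apply/eqP/negPn/negP.
by move=> /mP[].
Qed.

(** The unit of [R_e] projects onto the component at [e]: for another object [f], its products with
    [R_f] lie in both [R_e] and [R_f], hence vanish. *)
Lemma object_part s e u : ob G e -> (forall g, ~ ob G g -> scoef g s = 0) ->
  pset alpha e u -> (forall y, pset alpha e y -> u *' y = y /\ y *' u = y) ->
  u *' family_sum (val s) = scoef e s /\ family_sum (val s) *' u = scoef e s.
Proof.
move=> oe sP eu uP.
have es := scoef_pset e s.
have us f : f != e -> u *' scoef f s = 0 /\ scoef f s *' u = 0.
  move=> /eqP fe; have [of_|nf] := pselect (ob G f); last first.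
    by rewrite sP // rmulr0 rmul0r.
  have [_ _ eid] := pset_cod alpha e; have [_ _ fid] := pset_cod alpha f.
  rewrite !gcod_id // in eid fid; have fs := scoef_pset f s.
  have [? ?] := eid (scoef f s) u I eu; have [? ?] := fid u (scoef f s) I fs.
  by split; apply: (pset_ob_disjoint oe of_ (nesym fe)).
have split_sum (F : R -> R) : F 0 = 0 ->
    (forall f, f != e -> F (scoef f s) = 0) ->
    F (scoef e s) = scoef e s ->
    \sum_(g <- msupp (val s)) F (scoef g s) = scoef e s.
  move=> F0 F1 Fe; have [es'|es'] := boolP (e \in msupp (val s)).
    by rewrite (bigD1_seq e) ?fset_uniq //= Fe big1 ?addr0.
  have se : scoef e s = 0 by apply: mcoeff_outdom.
  rewrite big_seq big1 ?se // => g gs; apply: F1.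
  by apply: contra es' => /eqP <-.
split; rewrite /family_sum ?rmul_sumr ?rmul_suml.
  apply: (split_sum (fun y => u *' y)); rewrite ?rmulr0 //.
    by move=> f /us[].
  by have [] := uP _ es.
apply: (split_sum (fun y => y *' u)); rewrite ?rmul0r //.
  by move=> f /us[].
by have [] := uP _ es.
Qed.

(** The component at an object is a left multiple of the whole sum, by the unit of the corresponding
    summand. *)
Lemma object_parts_left_ideal s (J : set R) : left_ideal J ->
  (forall g, ~ ob G g -> scoef g s = 0) ->
  (forall g, J (scoef g s)) <-> J (family_sum (val s)).
Proof.
move=> [Jg Jm] sP; split=> [Js|Js g].
  exact: (subgroup_sum Jg (fun g _ _ => Js g)).
have [og|/sP->] := pselect (ob G g); last exact: subgroup0.
have [u gu uP] := unital_pset g.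
by have [<- _] := object_part og sP gu uP; apply: Jm.
Qed.

Lemma object_parts_right_ideal s (J : set R) : right_ideal J ->
  (forall g, ~ ob G g -> scoef g s = 0) ->
  (forall g, J (scoef g s)) <-> J (family_sum (val s)).
Proof.
move=> [Jg Jm] sP; split=> [Js|Js g].
  exact: (subgroup_sum Jg (fun g _ _ => Js g)).
have [og|/sP->] := pselect (ob G g); last exact: subgroup0.
have [u gu uP] := unital_pset g.
by have [_ <-] := object_part og sP gu uP; apply: Jm.
Qed.

Lemma left_noetherian_coef : left_noetherian A -> left_noetherian R.
Proof.
move=> noethA J Jideal Jmono; apply: stabilizesP => //.
(* Pulled back along [alpha_{g^-1}], the product [(x delta_g)(y delta_h)] has
   coefficient [alpha_{h^-1}(alpha_{g^-1}(x) 1_h) alpha_{h^-1}(y)], a left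
   multiple of the pulled back coefficient of [y delta_h]. *)
pose K n g := [set y | pset alpha g y /\ J n (pfun alpha (ginv g) y)].
have Kg n g : subgroup (K n g).
  have [Jg _] := Jideal n; split.
    by split; [apply: pset0|rewrite pfun0; apply: subgroup0].
  move=> x y [gx Jx] [gy Jy]; split; first exact: psetB.
  by rewrite pfunB ?ginvK //; apply: subgroupB.
have Eideal n : left_ideal (coef_in (alpha := alpha) (K n)).
  apply: coef_in_left_ideal => // g h x y gh gx hy [_ Jy].
  have [gc hc] := skew_coef_pset gh gx hy.
  have hc' := pfun_pset_mul gh gc hc; split=> //.
  set c := pfun alpha (ginv g) x *' y in gc hc hc' *.
  have vgh : gdom (ginv h) = gcod (ginv g) by rewrite gdomV gcodV.
  rewrite ginvM // -pfun_mul //; last first.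
    by split; rewrite /= ?pfunK ?ginvK //; apply: pfun_pset.
  rewrite pfunK //; have [u hu uP] := unital_pset h.
  have [_ Jm] := Jideal n.
  (* [alpha_{h^-1}] is multiplicative only on [R_h], where [alpha_{g^-1}(x)] need not lie; inserting
     the unit [u] of [R_h] moves the first factor there. *)
  have cE : c = (pfun alpha (ginv g) x *' u) *' y.
    by rewrite /c -rmulA; have [->] := uP y hy.
  have hxu : pset alpha h (pfun alpha (ginv g) x *' u).
    by have [] := skew_coef_pset gh gx hu.
  have := pfun_morph (p := alpha) (g := ginv h); rewrite ginvK.
  by move=> /(_ _ _ hxu hy)[_]; rewrite cE => ->; apply: Jm.
have Emono n : coef_in (alpha := alpha) (K n) `<=` coef_in (K n.+1).
  by move=> s Ks g; have [? ?] := Ks g; split=> //; apply: Jmono.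
have [N EN] := stabilizes_sub Emono (noethA _ Eideal Emono).
(* At an object the pullback is along an identity map, so nothing is twisted on elements supported
   on objects. *)
have KE n s : (forall g, ~ ob G g -> scoef g s = 0) ->
    coef_in (K n) s <-> J n (family_sum (val s)).
  move=> sP; rewrite -(object_parts_left_ideal (Jideal n) sP).
  have [Jg _] := Jideal n.
  split=> [Ks g|Js g]; have [og|/sP->] := pselect (ob G g).
  - by have [gs] := Ks g; rewrite ginv_ob // pfun_ob //; apply: mem_set.
  - exact: subgroup0.
  - split; first exact: scoef_pset.
    by rewrite ginv_ob // pfun_ob //; apply/mem_set/scoef_pset.
  - exact: subgroup0.
exists N => n x Jx; have [s sx sP] := object_parts x.
by rewrite -sx; apply/(KE N s sP)/EN/(KE n s sP); rewrite sx.
Qed.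

(** With [u] the unit of [R_{g^-1}], the product of [x delta_g] and [y delta_h] has coefficient
    [x alpha_g(u y)], a right multiple of [x] itself; so the family of coefficient conditions can be
    constant. *)
Lemma right_noetherian_coef : right_noetherian A -> right_noetherian R.
Proof.
move=> noethA J Jideal Jmono; apply: stabilizesP => //.
pose E n := coef_in (alpha := alpha) (fun=> J n).
have Eideal n : right_ideal (E n).
  have [Jg Jm] := Jideal n.
  apply: coef_in_right_ideal => // g h x y gh gx hy Jx.
  have vx : pset alpha (ginv g) (pfun alpha (ginv g) x).
    by apply: pfun_pset; rewrite ginvK.
  have [u gu uP] := unital_pset (ginv g).
  have guy : pset alpha (ginv g) (u *' y).
    by have [] // := psetM _ gu hy; rewrite gcodV.
  have -> : pfun alpha (ginv g) x *' y = pfun alpha (ginv g) x *' (u *' y).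
    by rewrite rmulA; have [_ ->] := uP _ vx.
  have [_ ->] := pfun_morph vx guy.
  by rewrite -[g in pfun alpha g (pfun _ _ _)]ginvK pfunK ?ginvK //; apply: Jm.
have Emono n : E n `<=` E n.+1 by move=> s Es g; apply: Jmono.
have [N EN] := stabilizes_sub Emono (noethA _ Eideal Emono).
exists N => n x Jx; have [s sx sP] := object_parts x.
rewrite -sx; apply/(object_parts_right_ideal (Jideal N) sP)/(EN n).
by apply/(object_parts_right_ideal (Jideal n) sP); rewrite sx.
Qed.

End CoefficientRing.

(** The zero ring has 0 as unit, so the excluded case is covered too. *)
Lemma unital_actionP (G : groupoid) (R : rngType) (alpha : partial_action G R) :
  unital_action alpha -> forall g, unital_set (pset alpha g).
Proof.
move=> ua g; have [g0|/ua//] := pselect (pset alpha g = [set 0]).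
by exists 0; rewrite g0 // => x ->; rewrite rmulr0.
Qed.

Lemma family_in_pset (G : groupoid) (R : rngType) (alpha : partial_action G R)
    (I : choiceType) (P : set I) (k : I -> G) (f : {malg R[I]}) i :
  family_in P (fun j => pset alpha (k j)) f -> pset alpha (k i) f@_i.
Proof.
by move=> /(_ i) fi; have [->|/fi[]//] := eqVneq f@_i 0; apply: pset0.
Qed.

(** * Global actions: simplified products and associativity *)

Section GlobalAction.
Variables (G : groupoid) (T : rngType) (beta : partial_action G T).
Hypothesis globalT : global_action beta.
Local Notation S := (partial_skew_groupoid_ring beta).
Implicit Types (g h k : G) (x y z : T).


(** Globality for the composable pair of [k] and [k^-1], whose product is [c(k)], puts [T_{c(k)}]
    inside [T_k]. *)
Lemma pset_gcod g h : gcod g = gcod h -> pset beta g = pset beta h.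
Proof.
suff E k : pset beta k = pset beta (gcod k) by move=> gh; rewrite E gh -E.
apply/seteqP; split; first exact: pset_sub_cod.
have [] := globalT (g := k) (h := ginv k); first by rewrite gcodV.
by rewrite gmulV ginvK ginv_ob // => -> _ x [].
Qed.

Lemma pfunA g h x : gdom g = gcod h -> pset beta (gdom h) x ->
  pfun beta g (pfun beta h x) = pfun beta (gmul g h) x.
Proof.
move=> gh hx; have [_ ->] // := globalT gh.
by rewrite (@pset_gcod _ (gdom h)) // gcodV gdomM // gcod_dom.
Qed.

Lemma pfun_gdom g x : pset beta (gdom g) x -> pset beta g (pfun beta g x).
Proof.
move=> dx; apply: pfun_pset.
by rewrite (@pset_gcod _ (gdom g)) ?gcodV ?gcod_dom.
Qed.

Lemma pfun_gdomM g x y : pset beta (gdom g) x -> pset beta (gdom g) y ->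
  pfun beta g (x *' y) = pfun beta g x *' pfun beta g y.
Proof.
rewrite -(@pset_gcod (ginv g)) ?gcodV ?gcod_dom // => dx dy.
by have [_ ->] := pfun_morph dx dy.
Qed.

Lemma pfun_gdomD g x y : pset beta (gdom g) x -> pset beta (gdom g) y ->
  pfun beta g (x + y) = pfun beta g x + pfun beta g y.
Proof.
by rewrite -(@pset_gcod (ginv g)) ?gcodV ?gcod_dom // => dx dy; apply: pfunD.
Qed.

Lemma pfun_surj g x : pset beta (gcod g) x ->
  exists2 y, pset beta (gdom g) y & pfun beta g y = x.
Proof.
rewrite -(@pset_gcod g) ?(gcod_id (gcod_ob g)) // => gx.
exists (pfun beta (ginv g) x).
  rewrite -(@pset_gcod (ginv g)) ?gcodV ?gcod_dom //.
  by apply: pfun_pset; rewrite ginvK.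
by rewrite -[g in pfun beta g]ginvK pfunK // ginvK.
Qed.

Lemma psetMg g x y : pset beta g x -> pset beta g y -> pset beta g (x *' y).
Proof. by move=> gx gy; have [] := psetM (erefl _) gx gy. Qed.

(** Here [beta_g] is multiplicative on all of [T_{d(g)}], so it distributes over the product and
    cancels [beta_{g^-1}] on [x]. *)
Lemma single_mulg g h x y : gdom g = gcod h ->
  pset beta g x -> pset beta h y ->
  single beta g x *' single beta h y =
    single beta (gmul g h) (x *' pfun beta g y).
Proof.
move=> gh gx hy; rewrite single_mul //; congr single.
have vx : pset beta (gdom g) (pfun beta (ginv g) x).
  rewrite -(@pset_gcod (ginv g)) ?gcodV ?gcod_dom //.
  by apply: pfun_pset; rewrite ginvK.
rewrite pfun_gdomM //; last by rewrite (@pset_gcod _ h) // gcod_dom.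
by rewrite -[g in pfun beta g (pfun _ _ _)]ginvK pfunK // ginvK.
Qed.

(** On homogeneous elements both sides vanish unless both pairs are composable; then both
    coefficients equal [x beta_g(y) beta_{gh}(z)]. *)
Lemma skew_mulA (r s t : S) : r *' (s *' t) = (r *' s) *' t.
Proof.
elim/skew_ind: r => [|r1 r2 E1 E2|g x gx].
- by rewrite !rmul0r.
- by rewrite !rmulDl E1 E2.
elim/skew_ind: s => [|s1 s2 E1 E2|h y hy].
- by rewrite !(rmul0r, rmulr0).
- by rewrite !(rmulDl, rmulDr) E1 E2.
elim/skew_ind: t => [|t1 t2 E1 E2|k z kz].
- by rewrite !(rmul0r, rmulr0).
- by rewrite !(rmulDl, rmulDr) E1 E2.
have dy : gdom g = gcod h -> pset beta (gdom g) y.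
  by move=> gh; rewrite (@pset_gcod _ h) // gcod_dom.
have dz : gdom h = gcod k -> pset beta (gdom h) z.
  by move=> hk; rewrite (@pset_gcod _ k) // gcod_dom.
have ghP : gdom g = gcod h -> pset beta (gmul g h) (x *' pfun beta g y).
  move=> gh; rewrite (@pset_gcod _ g) ?gcodM //; apply: psetMg => //.
  by apply: pfun_gdom; apply: dy.
have hkP : gdom h = gcod k -> pset beta (gmul h k) (y *' pfun beta h z).
  move=> hk; rewrite (@pset_gcod _ h) ?gcodM //; apply: psetMg => //.
  by apply: pfun_gdom; apply: dz.
have [hk|hk] := pselect (gdom h = gcod k); last first.
  rewrite [in LHS]single_mul0 // rmulr0.
  have [gh|gh] := pselect (gdom g = gcod h); last first.
    by rewrite single_mul0 ?rmul0r.
  by rewrite single_mulg // single_mul0 ?gdomM //; apply: ghP.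
rewrite [in LHS]single_mulg //.
have [gh|gh] := pselect (gdom g = gcod h); last first.
  by rewrite single_mul0 ?gcodM //; [rewrite single_mul0 ?rmul0r|apply: hkP].
rewrite !single_mulg ?gdomM ?gcodM //; [|exact: ghP|exact: hkP].
rewrite gmulA // -rmulA; congr (single _ _ (_ *' _)).
rewrite pfun_gdomM ?pfunA //; [exact: dz|exact: dy|].
rewrite (@pset_gcod _ h) ?gcod_dom //; apply: pfun_gdom; exact: dz.
Qed.

Section ObjectSum.
Variable X : {fset G}.
Hypothesis obX : ob G = [set` X].
Variable w : G -> T.
Hypothesis wT : forall e, ob G e -> pset beta e (w e).

(** Both [eps] and the identity of [S] have this shape, with [w e] the unit of [R_e] and of [T_e]
    respectively. *)
Definition objsum : S := \sum_(e <- X) single beta e (w e).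

Lemma obXE e : ob G e -> e \in X.
Proof. by rewrite obX. Qed.

Let obXI e : e \in X -> ob G e.
Proof. by rewrite obX. Qed.

Lemma objsum_mull g x : pset beta g x ->
  objsum *' single beta g x = single beta g (w (gcod g) *' x).
Proof.
move=> gx; have og := gcod_ob g; have cX := obXE og.
rewrite rmul_suml (bigD1_seq (gcod g)) ?fset_uniq //=.
rewrite single_mulg ?gdom_cod //; last exact: wT.
rewrite g1mul pfun_ob //; last first.
  by apply/mem_set; rewrite (@pset_gcod _ g) // gcod_id.
rewrite big_seq_cond big1 ?addr0 // => e /andP[/obXI oe eg].
by rewrite single_mul0 //; [rewrite oe; apply/eqP|apply: wT].
Qed.

Lemma objsum_mulr g x : pset beta g x ->
  single beta g x *' objsum = single beta g (x *' pfun beta g (w (gdom g))).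
Proof.
move=> gx; have og := gdom_ob g; have cX := obXE og.
rewrite rmul_sumr (bigD1_seq (gdom g)) ?fset_uniq //=.
rewrite single_mulg ?gcod_dom //; last exact: wT.
rewrite gmul1 big_seq_cond big1 ?addr0 // => e /andP[/obXI oe eg].
rewrite single_mul0 //; last exact: wT.
by rewrite gcod_id //; apply/eqP; rewrite eq_sym.
Qed.

End ObjectSum.

End GlobalAction.

(** * The embedding of the skew ring of [alpha] into that of [beta] *)

Section Globalization.
Variables (G : groupoid) (R T : rngType).
Variables (alpha : partial_action G R) (beta : partial_action G T).
Variable glob : globalization alpha beta.
Hypothesis unital_pset : forall g, unital_set (pset alpha g).
Local Notation A := (partial_skew_groupoid_ring alpha).
Local Notation S := (partial_skew_groupoid_ring beta).
Local Notation emb := (emb glob).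
Let globT : global_action beta := glob_global glob.
Implicit Types (g h k e : G).

Lemma embD e x y : ob G e -> pset alpha e x -> pset alpha e y ->
  emb e (x + y) = emb e x + emb e y.
Proof. by move=> oe ex ey; have [] := emb_morph glob oe ex ey. Qed.

Lemma embM e x y : ob G e -> pset alpha e x -> pset alpha e y ->
  emb e (x *' y) = emb e x *' emb e y.
Proof. by move=> oe ex ey; have [] := emb_morph glob oe ex ey. Qed.

Lemma emb0 e : ob G e -> emb e 0 = 0.
Proof.
move=> oe; apply: (addrI (emb e 0)).
by rewrite -embD ?addr0 //; apply: pset0.
Qed.

Lemma embB e x y : ob G e -> pset alpha e x -> pset alpha e y ->
  emb e (x - y) = emb e x - emb e y.
Proof.
move=> oe ex ey; apply/eqP; rewrite eq_sym subr_eq -embD ?subrK //.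
exact: psetB.
Qed.

Lemma emb_pset g x : pset alpha g x -> pset beta g (emb (gcod g) x).
Proof.
move=> gx; have oc := gcod_ob g; have [_ sub _] := glob_ideal glob oc.
rewrite (pset_gcod globT (esym (gcod_id oc))).
by apply: sub; exists x => //; apply: pset_sub_cod.
Qed.

Let emb_ob e x : ob G e -> pset alpha e x -> pset beta e (emb e x).
Proof. by move=> oe ex; rewrite -{2}(gcod_id oe); apply: emb_pset. Qed.

Definition embed (s : A) : S :=
  \sum_(g <- msupp (val s)) single beta g (emb (gcod g) (scoef g s)).

Lemma scoef_embed g s : scoef g (embed s) = emb (gcod g) (scoef g s).
Proof.
rewrite (big_morph (scoef g) (scoefD g) (scoef0 beta g)).
have E h : scoef g (single beta h (emb (gcod h) (scoef h s))) =
    if h == g then emb (gcod g) (scoef g s) else 0.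
  rewrite scoef_single; last exact/emb_pset/scoef_pset.
  by case: eqP => // ->.
under eq_bigr do rewrite E.
have [gs|gs] := boolP (g \in msupp (val s)).
  rewrite (bigD1_seq g) ?fset_uniq //= eqxx big1 ?addr0 // => h /negPf -> //.
have -> : scoef g s = 0 by apply: mcoeff_outdom.
by rewrite emb0 ?big1 // => h _; case: eqP.
Qed.

Let scoef_cod g (s : A) : pset alpha (gcod g) (scoef g s).
Proof. exact/pset_sub_cod/scoef_pset. Qed.

Lemma embedB s t : embed (s - t) = embed s - embed t.
Proof.
by apply: scoefP => g; rewrite !(scoefB, scoef_embed) embB.
Qed.

Lemma embedD s t : embed (s + t) = embed s + embed t.
Proof.
by apply: scoefP => g; rewrite !(scoefD, scoef_embed) embD.
Qed.

Lemma embed0 : embed 0 = 0.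
Proof. by rewrite -[X in embed X](subrr 0) embedB subrr. Qed.

Lemma embed_inj : injective embed.
Proof.
move=> s t st; apply: scoefP => g.
have injc : {in pset alpha (gcod g) &, injective (emb (gcod g))}.
  by apply: emb_inj.
by apply: injc; rewrite -?scoef_embed ?st //; apply/mem_set/scoef_cod.
Qed.

Lemma embed_single g x : pset alpha g x ->
  embed (single alpha g x) = single beta g (emb (gcod g) x).
Proof.
move=> gx; apply: scoefP => h; rewrite scoef_embed !scoef_single //.
  by case: eqP => [->|] // _; rewrite emb0.
exact: emb_pset.
Qed.

(** On homogeneous elements this is [glob_pfun] used twice, for the outer [alpha_g] and for the
    inner [alpha_{g^-1}]. *)
Lemma embedM s t : embed (s *' t) = embed s *' embed t.
Proof.
elim/skew_ind: s => [|s1 s2 E1 E2|g x gx].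
- by rewrite rmul0r embed0 rmul0r.
- by rewrite rmulDl !embedD rmulDl E1 E2.
elim/skew_ind: t => [|t1 t2 E1 E2|h y hy].
- by rewrite rmulr0 embed0 rmulr0.
- by rewrite rmulDr !embedD rmulDr E1 E2.
have [gh|gh] := pselect (gdom g = gcod h); last first.
  rewrite !embed_single // !single_mul0 ?embed0 //; exact: emb_pset.
have [gc hc] := skew_coef_pset gh gx hy.
rewrite !embed_single // !single_mul //; try exact: emb_pset.
rewrite embed_single; last exact: pfun_pset_mul.
congr single; rewrite gcodM // -glob_pfun //; congr pfun.
have od := gdom_ob g.
rewrite embM //; last first.
- by rewrite gh; apply: pset_sub_cod.
- by rewrite -gcodV; apply/pset_sub_cod/pfun_pset; rewrite ginvK.
have := glob_pfun glob (g := ginv g) (a := x).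
rewrite ginvK gdomV gcodV => -> //.
by rewrite gh.
Qed.

Let rone g : R := s2val (cid2 (unital_pset g)).
Let rone_pset g : pset alpha g (rone g). Proof. exact: s2valP. Qed.
Let roneP g x : pset alpha g x -> rone g *' x = x /\ x *' rone g = x.
Proof. exact: (s2valP' (cid2 (unital_pset g))). Qed.

Definition corner_unit e : T := emb e (rone e).
Local Notation E := corner_unit.

Lemma corner_unit_pset e : ob G e -> pset beta e (E e).
Proof. by move=> oe; apply: emb_ob. Qed.

Lemma corner_unitP e x : ob G e -> (emb e @` pset alpha e) x ->
  E e *' x = x /\ x *' E e = x.
Proof.
move=> oe [r er <-]; rewrite -!embM //; try exact: rone_pset.
by have [-> ->] := roneP er.
Qed.

Lemma corner_unit_ideal e x : ob G e -> pset beta e x ->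
  (emb e @` pset alpha e) (E e *' x) /\ (emb e @` pset alpha e) (x *' E e).
Proof.
move=> oe ex; have [_ _ Id] := glob_ideal glob oe.
by have [] := Id x (E e) ex; first by exists (rone e).
Qed.

(** * The ideals [beta_h(R_{d(h)})] and the unit of [T_e] *)

Definition translate h : set T :=
  pfun beta h @` (emb (gdom h) @` pset alpha (gdom h)).

(** [beta_h] carries [T_{d(h)}] multiplicatively onto [T_{c(h)}], so it sends ideals to ideals. *)
Lemma translate_ideal h x y : pset beta (gcod h) x -> translate h y ->
  translate h (x *' y) /\ translate h (y *' x).
Proof.
move=> cx [z Rz <-]; have [v dv <-] := pfun_surj globT cx.
have od := gdom_ob h; have [_ sub Id] := glob_ideal glob od.
have dz := sub _ Rz; have [? ?] := Id v z dv Rz.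
by rewrite -!(pfun_gdomM globT) //; split; [exists (v *' z)|exists (z *' v)].
Qed.

Lemma translate_unit h : exists2 v, translate h v &
  forall x, translate h x -> v *' x = x /\ x *' v = x.
Proof.
have od := gdom_ob h; have dE := corner_unit_pset od.
have [_ sub _] := glob_ideal glob od.
exists (pfun beta h (E (gdom h))).
  by exists (E (gdom h)) => //; exists (rone (gdom h)).
move=> _ [z Rz <-]; have [E1 E2] := corner_unitP od Rz.
by rewrite -!(pfun_gdomM globT) ?E1 ?E2 //; apply: sub.
Qed.

Lemma translate_pset h x : translate h x -> pset beta (gcod h) x.
Proof.
move=> [z Rz <-]; have od := gdom_ob h; have [_ sub _] := glob_ideal glob od.
have oc := gcod_ob h; rewrite -(pset_gcod globT (esym (gcod_id oc))).
by apply: (pfun_gdom globT); apply: sub.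
Qed.

(* The unit of a sum of two unital ideals is [u + v - u v]. *)
Lemma translates_unit e (hs : seq G) : ob G e ->
  (forall h, h \in hs -> gcod h = e) ->
  exists2 w, pset beta e w & forall h x, h \in hs -> translate h x ->
    w *' x = x /\ x *' w = x.
Proof.
move=> oe; elim: hs => [_|k hs IH hsP]; first by exists 0 => //; apply: pset0.
have [h hh|w ew wP] := IH; first by apply: hsP; rewrite in_cons hh orbT.
have ck : gcod k = e by apply: hsP; rewrite mem_head.
have [v kv vP] := translate_unit k.
have ev : pset beta e v by rewrite -ck; apply: translate_pset.
exists (w + v - w *' v).
  by apply: psetB; [apply: psetD|apply: psetMg].
(* On the new ideal [x w] stays inside, so [x w v = x w]; on the old ones [v x] stays inside, so
   [w v x = v x]. The remaining terms cancel. *)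
move=> h x; rewrite in_cons => /predU1P[->|hh] hx.
  have [vx xv] := vP x hx.
  have [|_ xwk] := translate_ideal (x := w) _ hx; first by rewrite ck.
  have [_ xwv] := vP _ xwk.
  rewrite rmulBl rmulDl -rmulA vx rmulBr rmulDr xv rmulA xwv.
  by rewrite ![_ + x - _]addrAC !subrr add0r.
have [wx xw] := wP h x hh hx.
have ch : gcod h = e by apply: hsP; rewrite in_cons hh orbT.
have [|vxh _] := translate_ideal (x := v) _ hx; first by rewrite ch.
have [wvx _] := wP _ _ hh vxh.
by rewrite rmulBl rmulDl -rmulA wx wvx rmulBr rmulDr rmulA xw !addrK.
Qed.

Hypothesis finite_alpha : finite_type alpha.

(** By [glob_sum], [T_e] is the sum of all [beta_h(R_{d(h)})] with [c(h) = e]. Finite type at [h^-1]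
    splits [R_{d(h)}] into the [R_{h^-1 g_i}], and [beta_h] maps each of these into
    [beta_{g_i}(R_{d(g_i)})] by [glob_pset]. So a common unit for the finitely many [g_i] serves all
    of [T_e]. *)
Lemma glob_unital e : ob G e -> unital_set (pset beta e).
Proof.
move=> oe; have [n [gs [gsc gsP]]] := finite_alpha oe.
have [h /codomP[i ->]|w ew wP] := @translates_unit e (codom gs) oe.
  exact: gsc.
pose W x := w *' x = x /\ x *' w = x.
have W0 : W 0 by rewrite /W rmulr0 rmul0r.
have WD x y : W x -> W y -> W (x + y).
  by move=> [x1 x2] [y1 y2]; rewrite /W rmulDl rmulDr x1 x2 y1 y2.
exists w => // x; have oe' := gcod_id oe.
rewrite (glob_sum glob) => -[f fP <-].
have {}fP h : f@_h != 0 -> gcod h = e /\ translate h f@_h.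
  by move=> /fP[]; rewrite /= oe'.
rewrite -/(W _) /family_sum big_seq; apply: (big_ind W) => // h.
rewrite -mcoeff_neq0 => /fP[ch [z [r dr <-] <-]].
have dV : gdom (ginv h) = e by rewrite gdomV.
have od := gdom_ob h; have [_ sub _] := glob_ideal glob od.
have [f' f'P <-] :
    sum_of_sets setT (fun i => pset alpha (gmul (ginv h) (gs i))) r.
  by rewrite -gsP // gcodV.
(* Membership is carried along because [emb] and [beta_h] are additive only on the relevant
   subsets. *)
pose Q s := pset alpha (gdom h) s /\ W (pfun beta h (emb (gdom h) s)).
suff [] : Q (family_sum f') by [].
rewrite /family_sum; apply: (big_ind Q).
- by split; rewrite ?emb0 ?pfun0 //; apply: pset0.
- move=> s t [ds Ws] [dt Wt]; split; first exact: psetD.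
  by rewrite embD // (pfun_gdomD globT) //; [apply: WD|exact: emb_ob..].
move=> i _; have ki := family_in_pset i f'P.
set k := gmul (ginv h) (gs i) in ki.
have vh : gdom (ginv h) = gcod (gs i) by rewrite dV gsc.
have ck : gcod k = gdom h by rewrite /k gcodM // gcodV.
have dk : gdom k = gdom (gs i) by rewrite /k gdomM.
have hk : gmul h k = gs i.
  by rewrite /k gmulA ?gcodV // gmulV ch -(gsc i) g1mul.
have : (emb (gcod k) @` pset alpha k) (emb (gcod k) f'@_i) by exists f'@_i.
rewrite glob_pset => -[_ [b [c dc cb] bE]].
split; first by rewrite -ck; apply: pset_sub_cod.
apply: (wP (gs i)); first exact: codom_f.
rewrite -ck -bE -cb (pfunA globT) //; last exact: emb_ob.
by rewrite hk; exists b; rewrite -?cb -?dk //; exists c.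
Qed.

(** * The corner cut out by [eps], and its fullness *)

Variable X : {fset G}.
Hypothesis obX : ob G = [set` X].

Let eps : S := objsum beta X E.

(** On degree [g], [eps] acts as the unit of [R_{c(g)}] from the left and as that of
    [beta_g(R_{d(g)})] from the right; by [glob_pset], [R_g] lies in both ideals. *)
Lemma corner_embed s : (eps *' embed s) *' eps = embed s.
Proof.
elim/skew_ind: s => [|s t Es Et|g x gx].
- by rewrite embed0 rmulr0 rmul0r.
- by rewrite embedD rmulDr rmulDl Es Et.
have oc := gcod_ob g; have od := gdom_ob g; have bx := emb_pset gx.
rewrite embed_single // (objsum_mull globT obX corner_unit_pset) //.
have [|-> _] := corner_unitP (x := emb (gcod g) x) oc.
  by exists x => //; apply: pset_sub_cod.
rewrite (objsum_mulr globT obX corner_unit_pset) //; congr single.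
have : (emb (gcod g) @` pset alpha g) (emb (gcod g) x) by exists x.
rewrite glob_pset => -[_ [z Rz <-]].
have [_ sub _] := glob_ideal glob od; have [_ zE] := corner_unitP od Rz.
by rewrite -(pfun_gdomM globT) ?zE //; [apply: sub|apply: corner_unit_pset].
Qed.

(** Cutting a coefficient by the same two units lands it in both ideals, whose intersection is [R_g]
    by [glob_pset]. *)
Lemma embed_corner s : exists a, embed a = (eps *' s) *' eps.
Proof.
elim/skew_ind: s => [|s t [a Ea] [b Eb]|g x gx].
- by exists 0; rewrite embed0 rmulr0 rmul0r.
- by exists (a + b); rewrite embedD rmulDr rmulDl Ea Eb.
have oc := gcod_ob g; have od := gdom_ob g; have cc := gcod_id oc.
rewrite (objsum_mull globT obX corner_unit_pset) //.
have cE := corner_unit_pset oc.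
have gE := corner_unit_pset od.
have cx : pset beta (gcod g) x by apply: pset_sub_cod.
have gEx : pset beta g (E (gcod g) *' x).
  by rewrite (pset_gcod globT (esym cc)); apply: psetMg.
rewrite (objsum_mulr globT obX corner_unit_pset) //.
have [r gr <-] : (emb (gcod g) @` pset alpha g)
    ((E (gcod g) *' x) *' pfun beta g (E (gdom g))).
  rewrite glob_pset; split.
    have [_ _ Id] := glob_ideal glob oc.
    have [cEx _] := corner_unit_ideal oc cx.
    have [] // := Id (pfun beta g (E (gdom g))) _ _ cEx.
    by rewrite -(pset_gcod globT (esym cc)); apply: (pfun_gdom globT).
  have [] := translate_ideal (h := g) (x := E (gcod g) *' x)
    (y := pfun beta g (E (gdom g))) => //.
  - exact: psetMg.
  - by exists (E (gdom g)) => //; exists (rone (gdom g)).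
by exists (single alpha g r); rewrite embed_single.
Qed.

Lemma corner_idem : eps *' eps = eps.
Proof.
rewrite {2}/eps /objsum rmul_sumr big_seq [RHS]big_seq; apply: eq_bigr => e eX.
have oe : ob G e by rewrite obX.
have eE := corner_unit_pset oe.
rewrite (objsum_mull globT obX corner_unit_pset) // gcod_id //.
by have [|-> _] // := corner_unitP (x := E e) oe; exists (rone e).
Qed.

(** The trace ideal [S eps S], in the form of list witnesses required by the corner equivalence. *)
Let trace (s : S) := exists ps : seq (S * S),
  \sum_(p <- ps) p.1 *' (eps *' p.2) = s.

Let trace0 : trace 0.
Proof. by exists [::]; rewrite big_nil. Qed.

Let traceD s t : trace s -> trace t -> trace (s + t).
Proof. by move=> [ps <-] [qs <-]; exists (ps ++ qs); rewrite big_cat. Qed.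

Lemma trace_single e x : ob G e -> pset beta e x -> trace (single beta e x).
Proof.
move=> oe; have ce := gcod_id oe; rewrite (glob_sum glob) => -[f fP <-].
pose Q y := pset beta e y /\ trace (single beta e y).
suff [] : Q (family_sum f) by [].
rewrite /family_sum big_seq; apply: (big_ind Q).
- by split; [apply: pset0|rewrite single0].
- move=> y z [ey ty] [ez tz]; split; first exact: psetD.
  by rewrite singleD //; apply: traceD.
move=> h; rewrite -mcoeff_neq0 => /fP[]; rewrite /= ce => ch th.
split; first by rewrite -ch; apply: translate_pset.
have od := gdom_ob h; case: th => z Rz <-.
have [_ sub _] := glob_ideal glob od; have dz := sub _ Rz.
have hz := pfun_gdom globT dz; have dE := corner_unit_pset od.
have vE : pset beta (ginv h) (E (gdom h)).
  by rewrite (pset_gcod globT (h := gdom h)) // gcodV gcod_dom.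
(* [eps] fixes the second factor, and the product of the two has degree [h h^-1 = e] and coefficient
   [beta_h(z) beta_h(1)], where 1 is the unit of [R_{d(h)}]. *)
exists [:: (single beta h (pfun beta h z), single beta (ginv h) (E (gdom h)))].
rewrite big_seq1 /= (objsum_mull globT obX corner_unit_pset) // gcodV.
have -> : E (gdom h) *' E (gdom h) = E (gdom h).
  have [|-> _] // := corner_unitP (x := E (gdom h)) od.
  by exists (rone (gdom h)).
rewrite (single_mulg globT) ?gcodV // gmulV ch -(pfun_gdomM globT) //.
by have [_ ->] := corner_unitP od Rz.
Qed.

(** The identity of [S] is the finite sum of the [1_{T_e} delta_e], and each term lies in the trace
    ideal by [trace_single]. *)
Lemma glob_corner_full : exists ps : seq (S * S),
  let one := \sum_(p <- ps) p.1 *' (eps *' p.2) in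
  (forall s, one *' s = s) /\ (forall s, s *' one = s).
Proof.
(* The value 0 off the objects is only a default: [objsum] runs over [X], the set of objects. *)
pose w e : T :=
  if pselect (ob G e) is left oe then s2val (cid2 (glob_unital oe)) else 0.
have ww e (oe : ob G e) : pset beta e (w e) /\
    forall x, pset beta e x -> w e *' x = x /\ x *' w e = x.
  rewrite /w; case: pselect => // oe'; split; first exact: s2valP.
  exact: (s2valP' (cid2 (glob_unital oe'))).
have wT e (oe : ob G e) : pset beta e (w e) by have [] := ww e oe.
have [ps psE] : trace (objsum beta X w).
  rewrite /objsum big_seq; apply: (big_ind trace) => // e eX.
  by apply: trace_single; [rewrite obX|apply: wT; rewrite obX].
exists ps; rewrite /= psE; split=> s.
  elim/skew_ind: s => [|s t Es Et|g x gx]; rewrite ?rmulr0 //.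
    by rewrite rmulDr Es Et.
  rewrite (objsum_mull globT obX wT) //.
  by have [_ /(_ x)[|->]] := ww _ (gcod_ob g); first exact: pset_sub_cod.
elim/skew_ind: s => [|s t Es Et|g x gx]; rewrite ?rmul0r //.
  by rewrite rmulDl Es Et.
rewrite (objsum_mulr globT obX wT) //; congr single.
have cx : pset beta (gcod g) x by apply: pset_sub_cod.
have [y dy <-] := pfun_surj globT cx.
have [dw wP] := ww _ (gdom_ob g).
by rewrite -(pfun_gdomM globT) //; have [_ ->] := wP y dy.
Qed.

End Globalization.

Theorem corollary6p8 (G : groupoid) (R T : rngType)
    (alpha : partial_action G R) (beta : partial_action G T)
    (glob : globalization alpha beta)
    (unital_alpha : unital_action alpha)
    (finite_ob : finite_set (ob G))
    (finite_alpha : finite_type alpha) :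
  ((left_noetherian (partial_skew_groupoid_ring alpha) <->
      left_noetherian (partial_skew_groupoid_ring beta)) /\
   (left_noetherian (partial_skew_groupoid_ring alpha) ->
      left_noetherian R /\ left_noetherian T)) /\
  ((right_noetherian (partial_skew_groupoid_ring alpha) <->
      right_noetherian (partial_skew_groupoid_ring beta)) /\
   (right_noetherian (partial_skew_groupoid_ring alpha) ->
      right_noetherian R /\ right_noetherian T)).
Proof.
have /finite_fsetP[X obX] := finite_ob.
have ualpha := unital_actionP unital_alpha.
have globT := glob_global glob.
(* Every [T_g] equals [T_{c(g)}] and so is unital; the descent to coefficients therefore applies to
   [beta] as it does to [alpha]. *)
have ubeta g : unital_set (pset beta g).
  have oc := gcod_ob g; rewrite (pset_gcod globT (esym (gcod_id oc))).
  exact: (glob_unital glob ualpha finite_alpha).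
have mulA := skew_mulA globT.
have [ps [mul1s muls1]] := glob_corner_full glob ualpha finite_alpha obX.
have leftE := left_noetherian_cornerE mulA (embedB glob) (embedM glob)
  (@embed_inj _ _ _ _ _ glob) (corner_embed glob ualpha obX)
  (embed_corner glob ualpha obX) (corner_idem glob ualpha obX) mul1s muls1.
have rightE := right_noetherian_cornerE mulA (embedB glob) (embedM glob)
  (@embed_inj _ _ _ _ _ glob) (corner_embed glob ualpha obX)
  (embed_corner glob ualpha obX) (corner_idem glob ualpha obX) mul1s muls1.
split; split=> // noethA; split.
- exact: left_noetherian_coef ualpha noethA.
- by apply: left_noetherian_coef ubeta _; apply/leftE.
- exact: right_noetherian_coef ualpha noethA.
- by apply: right_noetherian_coef ubeta _; apply/rightE.
Qed.
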